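(* Let $p$ be a prime, $\mathbb{F}_q$ a finite field of characteristic $p$, $n\ge1$, $s_1,\dots,s_n$ positive integers, and $N_1,\dots,N_n$ integers with $0\le N_j\le p^{s_j}$. Let $$C=\langle (x_1-1)^{N_1}\cdots(x_n-1)^{N_n}\rangle\subset\mathcal{R}=\frac{\mathbb{F}_q[x_1,\dots,x_n]}{\langle x_1^{p^{s_1}}-1,\dots,x_n^{p^{s_n}}-1\rangle}.$$ For $1\le j\le n$ let $$T_j=\{(a_1,\dots,a_n)\in\mathbb{N}^n:\ 0\le a_l<p^{s_l}\text{ for all } l,\ \text{and } p^{s_j}-N_j\le a_j<p^{s_j}\},$$ and let $T=T_1\cup\cdots\cup T_n$. Then the set $$B=\{(x_1-1)^{a_1}\cdots(x_n-1)^{a_n}:\ (a_1,\dots,a_n)\in T\}$$ is an $\mathbb{F}_q$-basis of $C^\perp$.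
   Context: $\mathbb{N}=\{0,1,2,\dots\}$. Each element of $\mathcal{R}$ is identified with its unique representative $f=\sum f_{(a_1,\dots,a_n)}x_1^{a_1}\cdots x_n^{a_n}$ with $0\le a_j<p^{s_j}$, hence with the vector of its coefficients in $\mathbb{F}_q^{p^{s_1}\cdots p^{s_n}}$. $C^\perp$ is the dual code of $C$, i.e. the set of all $f\in\mathcal{R}$ with $\sum_{a}f_a g_a=0$ for all $g\in C$ (standard dot product of coefficient vectors). *)

(* Defs.v *)
From HB Require Import structures.
From mathcomp Require Import all_boot all_algebra.
From mathcomp Require Import boolp ssrcomplements mpoly.

Set Implicit Arguments.
Unset Strict Implicit.
Unset Printing Implicit Defensive.

Import GRing.Theory.
Local Open Scope ring_scope.
Local Open Scope quotient_scope.

Section CyclicIdeal.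
Variables (F : fieldType) (n : nat) (d : 'I_n -> nat).

(* Membership in <x_1^(d 1) - 1, ..., x_n^(d n) - 1>, made boolean classically
   because {ideal_quot _} expects a boolean predicate. *)
Definition cycIdeal : {pred {mpoly F[n]}} := fun f =>
  `[< exists c : 'I_n -> {mpoly F[n]}, f = \sum_i c i * ('X_i ^+ d i - 1) >].

Lemma cycIdealP f :
  reflect (exists c : 'I_n -> {mpoly F[n]}, f = \sum_i c i * ('X_i ^+ d i - 1))
          (f \in cycIdeal).
Proof. exact: asboolP. Qed.

Lemma cycIdeal_closed : idealr_closed cycIdeal.
Proof.
split.
- by apply/cycIdealP; exists (fun=> 0); rewrite big1 // => i _; rewrite mul0r.
- apply/cycIdealP=> -[c /(congr1 (meval (fun=> 1)))].
  rewrite meval1 raddf_sum big1 => [/eqP|i _]; first by rewrite oner_eq0.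
  by rewrite /= mevalM mevalB rmorphXn /= mevalXU meval1 expr1n subrr mulr0.
- move=> a u v /cycIdealP[cu ->] /cycIdealP[cv ->]; apply/cycIdealP.
  exists (fun i => a * cu i + cv i); rewrite mulr_sumr -big_split /=.
  by apply: eq_bigr => i _; rewrite mulrDl mulrA.
Qed.

HB.instance Definition _ := isIdealr.Build {mpoly F[n]} cycIdeal cycIdeal_closed.

End CyclicIdeal.

(* F[x_1,...,x_n] / <x_1^(d 1) - 1, ..., x_n^(d n) - 1>.  The positivity proof
   is a parameter because finite dimensionality depends on it. *)
Definition cycRing (F : fieldType) (n : nat) (d : 'I_n -> nat)
    of (forall i, (0 < d i)%N) : Type := {ideal_quot (@cycIdeal F n d)}.

Section CyclicRing.
Variables (F : fieldType) (n : nat) (d : 'I_n -> nat).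
Hypothesis d_gt0 : forall i, (0 < d i)%N.

Local Notation R := (cycRing F d_gt0).
Local Notation Q := {ideal_quot (@cycIdeal F n d)}.

HB.instance Definition _ := GRing.ComNzRing.on R.

Definition cycProj (f : {mpoly F[n]}) : R := \pi_Q f.

Fact cycProj_zmod : zmod_morphism cycProj.
Proof. by move=> f g; rewrite /cycProj rmorphB. Qed.
Fact cycProj_monoid : monoid_morphism cycProj.
Proof.
by split=> [|f g]; rewrite /cycProj ?rmorph1 ?rmorphM.
Qed.
HB.instance Definition _ :=
  GRing.isZmodMorphism.Build {mpoly F[n]} R cycProj cycProj_zmod.
HB.instance Definition _ :=
  GRing.isMonoidMorphism.Build {mpoly F[n]} R cycProj cycProj_monoid.

Lemma cycProj_eq f g : (cycProj f == cycProj g) = (f - g \in @cycIdeal F n d).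
Proof. by rewrite Quotient.idealrBE. Qed.

Definition cycVar (i : 'I_n) : R := cycProj 'X_i.

Lemma cycVarX i : cycVar i ^+ d i = 1.
Proof.
rewrite /cycVar -rmorphXn -[1](rmorph1 cycProj); apply/eqP.
rewrite cycProj_eq; apply/cycIdealP; exists (fun j => (j == i)%:R).
rewrite (bigD1 i) //= eqxx mul1r big1 ?addr0 // => j /negbTE->.
by rewrite mul0r.
Qed.

Definition cycScale (c : F) (f : R) : R := cycProj c%:MP * f.

Fact cycScaleA a b f : cycScale a (cycScale b f) = cycScale (a * b) f.
Proof. by rewrite /cycScale mulrA -rmorphM -mpolyCM. Qed.
Fact cycScale1 : left_id 1 cycScale.
Proof. by move=> f; rewrite /cycScale rmorph1 mul1r. Qed.
Fact cycScaleDr : right_distributive cycScale +%R.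
Proof. by move=> a f g; rewrite /cycScale mulrDr. Qed.
Fact cycScaleDl f : {morph cycScale^~ f : a b / a + b}.
Proof. by move=> a b; rewrite /cycScale mpolyCD rmorphD mulrDl. Qed.
HB.instance Definition _ := GRing.Zmodule_isLmodule.Build F R
  cycScaleA cycScale1 cycScaleDr cycScaleDl.

Lemma cycProjZ c f : cycProj (c *: f) = c *: cycProj f.
Proof. by rewrite -mul_mpolyC rmorphM. Qed.

Definition reduced (f : {mpoly F[n]}) : bool :=
  all (fun m : 'X_{1..n} => [forall i, m i < d i]%N) (msupp f).

Definition mnmMod (m : 'X_{1..n}) : 'X_{1..n} := [multinom m i %% d i | i < n]%N.

Definition cycRed (f : {mpoly F[n]}) : {mpoly F[n]} :=
  \sum_(m <- msupp f) f@_m *: 'X_[mnmMod m].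

Lemma cycRedE k f : (msize f <= k)%N ->
  cycRed f = \sum_(m : 'X_{1..n < k}) f@_m *: 'X_[mnmMod m].
Proof.
move=> le_fk; pose I : subFinType _ := 'X_{1..n < k}.
rewrite /cycRed (big_mksub I) ?msupp_uniq //= => [|m /msize_mdeg_lt]; last first.
  by move=> /leq_trans; apply.
by rewrite big_rmcond //= => m /memN_msupp_eq0 ->; rewrite scale0r.
Qed.

Lemma cycRed_linear a f g : cycRed (a *: f + g) = a *: cycRed f + cycRed g.
Proof.
pose k := maxn (msize (a *: f + g)) (maxn (msize f) (msize g)).
rewrite !(cycRedE (k := k)) ?leq_max ?leqnn ?orbT //.
rewrite scaler_sumr -big_split /=; apply: eq_bigr => m _.
by rewrite mcoeffD mcoeffZ scalerDl scalerA.
Qed.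
HB.instance Definition _ := GRing.isLinear.Build F {mpoly F[n]} {mpoly F[n]} _
  cycRed cycRed_linear.

Lemma cycRedX m : cycRed 'X_[m] = 'X_[mnmMod m].
Proof. by rewrite /cycRed msuppX big_seq1 mcoeffX eqxx scale1r. Qed.

Lemma cycRed_ideal f : f \in @cycIdeal F n d -> cycRed f = 0.
Proof.
move=> /cycIdealP[c ->]; rewrite raddf_sum big1 // => i _.
rewrite [c i]mpolyE mulr_suml raddf_sum big1 // => m _.
rewrite -scalerAl /= linearZ /= mulrBr mulr1 linearB /= mpolyXn -mpolyXD !cycRedX.
suff -> : mnmMod (m + U_(i) *+ d i) = mnmMod m by rewrite subrr scaler0.
apply/mnmP => j; rewrite !mnmE mulmnE mnm1E.
by case: eqP => [<-|_]; rewrite ?mul0n ?addn0 // mul1n modnDr.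
Qed.

Lemma cycRed_reduced f : reduced (cycRed f).
Proof.
apply/allP => m; rewrite /cycRed => /msupp_sum_le /flattenP[_ /mapP[m' _ ->]].
move=> /msuppZ_le; rewrite msuppX mem_seq1 => /eqP->.
by apply/forallP => i; rewrite mnmE ltn_mod d_gt0.
Qed.

Lemma cycRed_id f : reduced f -> cycRed f = f.
Proof.
move=> /allP f_red; rewrite /cycRed [RHS]mpolyE big_seq [RHS]big_seq.
apply: eq_bigr => m /f_red /forallP m_lt; congr (_ *: 'X_[_]).
by apply/mnmP => i; rewrite mnmE modn_small.
Qed.

Lemma cycProj_red f : cycProj (cycRed f) = cycProj f.
Proof.
rewrite /cycRed [in RHS](mpolyE f) !raddf_sum; apply: eq_bigr => m _ /=.
rewrite !cycProjZ; congr (_ *: _).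
rewrite !mpolyXE_id !rmorph_prod /=; apply: eq_bigr => i _.
rewrite !rmorphXn /= mnmE -/(cycVar i) [in RHS](divn_eq (m i) (d i)).
by rewrite exprD mulnC exprM cycVarX expr1n mul1r.
Qed.

(* The reduced representative; unique by cycRep_unique below. *)
Definition cycRep (f : R) : {mpoly F[n]} := cycRed (repr (f : Q)).

Lemma cycRepK : cancel cycRep cycProj.
Proof. by move=> f; rewrite cycProj_red /cycProj reprK. Qed.

Lemma cycRep_reduced f : reduced (cycRep f).
Proof. exact: cycRed_reduced. Qed.

Lemma cycProjK f : cycRep (cycProj f) = cycRed f.
Proof.
apply/eqP; rewrite -subr_eq0 -linearB /=; apply/eqP/cycRed_ideal.
by rewrite -cycProj_eq; apply/eqP; rewrite /cycProj reprK.
Qed.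

Lemma cycRep_unique f g : reduced f -> cycProj f = g -> f = cycRep g.
Proof. by move=> f_red <-; rewrite cycProjK cycRed_id. Qed.

Lemma cycRep_linear a f g : cycRep (a *: f + g) = a *: cycRep f + cycRep g.
Proof.
rewrite -[f in LHS]cycRepK -[g in LHS]cycRepK -cycProjZ -rmorphD cycProjK.
by rewrite linearP /= !cycRed_id ?cycRep_reduced.
Qed.
HB.instance Definition _ := GRing.isLinear.Build F R {mpoly F[n]} _
  cycRep cycRep_linear.

Definition expBox : finType := {dffun forall i : 'I_n, 'I_(d i)}.

Definition boxMnm (a : expBox) : 'X_{1..n} := [multinom (a i : nat) | i < n].

Lemma boxMnm_inj : injective boxMnm.
Proof.
move=> a b /mnmP eq_ab; apply/ffunP => i; apply: val_inj.
by have := eq_ab i; rewrite !mnmE.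
Qed.

Lemma boxMnm_ex (m : 'X_{1..n}) : (forall i, m i < d i)%N -> exists a, boxMnm a = m.
Proof.
move=> m_lt; exists [ffun i => Ordinal (m_lt i)].
by apply/mnmP => i; rewrite mnmE ffunE.
Qed.

(* The coordinate of f at a in F^(d 1 * ... * d n). *)
Definition cycCoef (f : R) (a : expBox) : F := (cycRep f)@_(boxMnm a).

Fact cyc_vect_iso : Vector.axiom #|expBox| R.
Proof.
exists (fun f => \row_k cycCoef f (enum_val k)).
  move=> a f g; apply/rowP => k.
  by rewrite !mxE /cycCoef linearP mcoeffD mcoeffZ.
pose P (v : 'rV[F]_#|expBox|) : {mpoly F[n]} :=
  \sum_(a : expBox) v 0 (enum_rank a) *: 'X_[boxMnm a].
have coefP v a : (P v)@_(boxMnm a) = v 0 (enum_rank a).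
  rewrite raddf_sum (bigD1 a) //= big1 => [|b neq_ba].
    by rewrite addr0 mcoeffZ mcoeffX eqxx mulr1.
  by rewrite mcoeffZ mcoeffX (inj_eq boxMnm_inj) (negbTE neq_ba) mulr0.
have redP v : reduced (P v).
  apply/allP => m /msupp_sum_le /flattenP[_ /mapP[a _ ->]].
  move=> /msuppZ_le; rewrite msuppX mem_seq1 => /eqP->.
  by apply/forallP => i; rewrite mnmE ltn_ord.
exists (fun v => cycProj (P v)) => [f|v].
  rewrite -[RHS]cycRepK; congr cycProj; apply/mpolyP => m.
  case: (boolP [forall i, m i < d i]%N) => [/forallP/boxMnm_ex[a <-]|m_ge].
    by rewrite coefP mxE enum_rankK.
  rewrite !memN_msupp_eq0 //; apply: contra m_ge.
    by move: (cycRep_reduced f) => /allP; apply.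
  by move: (redP (\row_k cycCoef f (enum_val k))) => /allP; apply.
by apply/rowP => k; rewrite mxE /cycCoef cycProjK cycRed_id // coefP enum_valK.
Qed.
HB.instance Definition _ :=
  Lmodule_hasFinDim.Build F R cyc_vect_iso.

Definition principalIdeal (g : R) (f : R) : Prop := exists h : R, f = h * g.

Definition dualCode (C : R -> Prop) (f : R) : Prop :=
  forall g : R, C g -> \sum_(a : expBox) cycCoef f a * cycCoef g a = 0.

End CyclicRing.

(* basis_of needs a {vspace V}; S is only a Prop-valued subset, so part of the
   claim is that S is a subspace. *)
Definition basisOfSet (K : fieldType) (V : vectType K)
    (S : V -> Prop) (X : seq V) : Prop :=
  exists U : {vspace V}, (forall v, v \in U <-> S v) /\ basis_of U X.

Lemma prime_exp_gt0 (p n : nat) (s : 'I_n -> nat) :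
  prime p -> forall i, (0 < p ^ s i)%N.
Proof. by move=> p_pr i; rewrite expn_gt0 prime_gt0. Qed.

(* Main.v *)
Require Import Defs.
From mathcomp Require Import all_boot all_algebra.
From mathcomp Require Import mpoly.

Set Implicit Arguments.
Unset Strict Implicit.
Unset Printing Implicit Defensive.

Import GRing.Theory.
Local Open Scope ring_scope.

(* Multiplication by x_i preserves the dot product, so the adjoint of
   multiplication by x_i - 1 is multiplication by
   x_i^-1 - 1 = -x_i^-1 (x_i - 1), an associate of x_i - 1.  Hence the dual of
   a code generated by a product g of powers of the x_i - 1 is the annihilator
   of g.  In characteristic p we have (x_i - 1)^(p^(s_i)) = 0, and the products
   of the (x_i - 1)^(a_i) form a basis of the ring.  Multiplication by g
   translates the exponents of these products by N: it kills those with a in T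
   and sends the other ones to distinct basis elements, so its kernel is spanned
   by those with a in T. *)

Section CyclicDot.
Variables (F : fieldType) (n : nat) (d : 'I_n -> nat).
Hypothesis d_gt0 : forall i, (0 < d i)%N.

Local Notation R := (cycRing F d_gt0).
Local Notation x i := (cycVar F d_gt0 i).
Local Notation box := (expBox d).

(** * Monomials and coordinates in the quotient ring *)

Definition cycMon (m : 'X_{1..n}) : R := cycProj d_gt0 'X_[m].

Lemma cycMonE m : cycMon m = \prod_i x i ^+ m i.
Proof.
rewrite /cycMon mpolyXE_id rmorph_prod.
by apply: eq_bigr => i _; rewrite rmorphXn.
Qed.

Lemma cycMonD m m' : cycMon (m + m') = cycMon m * cycMon m'.
Proof. by rewrite /cycMon mpolyXD rmorphM. Qed.

Lemma cycMon_sum (f : R) :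
  f = \sum_(m <- msupp (cycRep f)) (cycRep f)@_m *: cycMon m.
Proof.
rewrite -[LHS]cycRepK [cycRep f in LHS]mpolyE raddf_sum.
by apply: eq_bigr => m _; exact: cycProjZ.
Qed.

Lemma cycCoefD (f g : R) a : cycCoef (f + g) a = cycCoef f a + cycCoef g a.
Proof. by rewrite /cycCoef linearD mcoeffD. Qed.

Lemma cycCoefZ c (f : R) a : cycCoef (c *: f) a = c * cycCoef f a.
Proof. by rewrite /cycCoef linearZ mcoeffZ. Qed.

Lemma cycCoef0 a : cycCoef (0 : R) a = 0.
Proof. by rewrite /cycCoef linear0 mcoeff0. Qed.

Lemma cycCoef_mon m a : cycCoef (cycMon m) a = (mnmMod d m == boxMnm a)%:R.
Proof. by rewrite /cycCoef cycProjK cycRedX mcoeffX. Qed.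

Lemma cycCoef_inj (f g : R) : cycCoef f =1 cycCoef g -> f = g.
Proof.
move=> eq_fg; rewrite -[f]cycRepK -[g]cycRepK; congr cycProj; apply/mpolyP => m.
case: (boolP [forall i, m i < d i]%N) => [/forallP/boxMnm_ex[a <-]|m_ge].
  exact: eq_fg.
rewrite !memN_msupp_eq0 //; apply: contra m_ge;
  exact: (allP (cycRep_reduced _)).
Qed.

Lemma boxMnm_mod (m : 'X_{1..n}) : exists a : box, boxMnm a = mnmMod d m.
Proof. by apply: boxMnm_ex => i; rewrite mnmE ltn_mod. Qed.

Lemma mnmMod_box (a : box) : mnmMod d (boxMnm a) = boxMnm a.
Proof. by apply/mnmP => i; rewrite !mnmE modn_small. Qed.

(** * The dot product as a symmetric bilinear form *)

Definition cycDot (f g : R) : F := \sum_(a : box) cycCoef f a * cycCoef g a.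

Lemma cycDotC f g : cycDot f g = cycDot g f.
Proof. by apply: eq_bigr => a _; rewrite mulrC. Qed.

Lemma cycDotDl f g h : cycDot (f + g) h = cycDot f h + cycDot g h.
Proof.
by rewrite -big_split; apply: eq_bigr => a _; rewrite cycCoefD mulrDl.
Qed.

Lemma cycDotZl c f h : cycDot (c *: f) h = c * cycDot f h.
Proof. by rewrite mulr_sumr; apply: eq_bigr => a _; rewrite cycCoefZ mulrA. Qed.

Lemma cycDot0l h : cycDot 0 h = 0.
Proof. by apply: big1 => a _; rewrite cycCoef0 mul0r. Qed.

Lemma cycDotBl f g h : cycDot (f - g) h = cycDot f h - cycDot g h.
Proof. by rewrite cycDotDl -scaleN1r cycDotZl mulN1r. Qed.

Lemma cycDotBr f g h : cycDot h (f - g) = cycDot h f - cycDot h g.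
Proof. by rewrite !(cycDotC h) cycDotBl. Qed.

Lemma cycDot_suml I (r : seq I) (c : I -> F) (f : I -> R) h :
  cycDot (\sum_(i <- r) c i *: f i) h = \sum_(i <- r) c i * cycDot (f i) h.
Proof.
elim/big_rec2: _ => [|i y z _ <-]; first exact: cycDot0l.
by rewrite cycDotDl cycDotZl.
Qed.

Lemma cycDot_mon m m' :
  cycDot (cycMon m) (cycMon m') = (mnmMod d m == mnmMod d m')%:R.
Proof.
have [a a_m] := boxMnm_mod m.
rewrite /cycDot (bigD1 a) //= big1 => [|b /negbTE b_a].
  by rewrite !cycCoef_mon a_m eqxx mul1r addr0 eq_sym.
by rewrite cycCoef_mon -a_m (inj_eq (@boxMnm_inj _ _)) eq_sym b_a mul0r.
Qed.

Lemma cycDot_box f (a : box) : cycDot f (cycMon (boxMnm a)) = cycCoef f a.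
Proof.
rewrite /cycDot (bigD1 a) //= big1 => [|b /negbTE b_a].
  by rewrite cycCoef_mon mnmMod_box eqxx mulr1 addr0.
by rewrite cycCoef_mon mnmMod_box (inj_eq (@boxMnm_inj _ _)) eq_sym b_a mulr0.
Qed.

Lemma cycDot_nondegenerate f : (forall g, cycDot f g = 0) -> f = 0.
Proof.
by move=> f0; apply: cycCoef_inj => a; rewrite -cycDot_box f0 cycCoef0.
Qed.

Lemma cycScaleAr c (f g : R) : f * (c *: g) = c *: (f * g).
Proof. exact: mulrCA. Qed.

Lemma cycScaleAl c (f g : R) : c *: f * g = c *: (f * g).
Proof. by rewrite [LHS]mulrC cycScaleAr mulrC. Qed.

(** The monomials of the box are orthonormal, and multiplication by [x i] permutes them, since
    adding [U_(i)] to exponents is injective modulo [d]. *)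
Lemma cycDot_isometry i f g : cycDot (x i * f) (x i * g) = cycDot f g.
Proof.
have xM h : x i * h =
    \sum_(m <- msupp (cycRep h)) (cycRep h)@_m *: cycMon (U_(i) + m).
  rewrite [in LHS](cycMon_sum h) mulr_sumr; apply: eq_bigr => m _.
  by rewrite cycScaleAr cycMonD.
rewrite !xM [in RHS](cycMon_sum f) [in RHS](cycMon_sum g) !cycDot_suml.
apply: eq_bigr => m _; congr (_ * _).
(* Expansion of sums is set up for the left argument, so the two arguments are swapped to expand the
   second one. *)
rewrite cycDotC [RHS]cycDotC !cycDot_suml; apply: eq_bigr => m' _.
rewrite !cycDot_mon; congr (_ * (nat_of_bool _)%:R).
apply/eqP/eqP => /mnmP eq_mm; apply/mnmP => j; move/eqP: (eq_mm j);
  by rewrite !mnmE ?eqn_modDl => ?; apply/eqP; rewrite ?eqn_modDl.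
Qed.

(** * Adjoints of multiplications, and the dual code as an annihilator *)

Definition cycAdjoint (u v : R) :=
  forall f g, cycDot f (u * g) = cycDot (v * f) g.

Lemma cycAdjoint1 : cycAdjoint 1 1.
Proof. by move=> f g; rewrite !mul1r. Qed.

Lemma cycAdjointB u v u' v' :
  cycAdjoint u v -> cycAdjoint u' v' -> cycAdjoint (u - u') (v - v').
Proof. by move=> uv uv' f g; rewrite !mulrBl cycDotBr cycDotBl uv uv'. Qed.

Lemma cycAdjointM u v u' v' :
  cycAdjoint u v -> cycAdjoint u' v' -> cycAdjoint (u * u') (v * v').
Proof. by move=> uv uv' f g; rewrite -mulrA uv uv' mulrA [v' * v]mulrC. Qed.

Lemma cycAdjointX u v k : cycAdjoint u v -> cycAdjoint (u ^+ k) (v ^+ k).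
Proof.
move=> uv; elim: k => [|k IHk]; first exact: cycAdjoint1.
by rewrite !exprS; apply: cycAdjointM.
Qed.

Lemma cycAdjoint_prod I (r : seq I) (u v : I -> R) :
  (forall i, cycAdjoint (u i) (v i)) ->
  cycAdjoint (\prod_(i <- r) u i) (\prod_(i <- r) v i).
Proof.
move=> uv; elim/big_ind2: _ => [|? ? ? ?|i _]; [exact: cycAdjoint1| |exact: uv].
exact: cycAdjointM.
Qed.

Definition cycVarInv i : R := x i ^+ (d i).-1.

Lemma cycVarVK i : x i * cycVarInv i = 1.
Proof. by rewrite -exprS prednK // cycVarX. Qed.

(** The adjoint of an invertible isometry is its inverse. *)
Lemma cycAdjoint_var i : cycAdjoint (x i) (cycVarInv i).
Proof.
by move=> f g; rewrite -[RHS](cycDot_isometry i) mulrA cycVarVK mul1r.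
Qed.

Definition shiftPow (m : 'I_n -> nat) : R := \prod_i (x i - 1) ^+ m i.

(** By nondegeneracy, [f] is orthogonal to all multiples of [shiftPow N] exactly when the adjoint
    multiplier [g] kills [f]. As [g] and [shiftPow N] divide each other, they have the same
    annihilator. *)
Lemma dualCode_principal (N : 'I_n -> nat) f :
  dualCode (principalIdeal (shiftPow N)) f <-> f * shiftPow N = 0.
Proof.
pose g := \prod_i (cycVarInv i - 1) ^+ N i.
have adj : cycAdjoint (shiftPow N) g.
  apply: cycAdjoint_prod => i; apply/cycAdjointX/cycAdjointB.
    exact: cycAdjoint_var.
  exact: cycAdjoint1.
(* With [y] the inverse of [x], the two divisibilities come from [y - 1 = - y * (x - 1)] and
   [x - 1 = - x * (y - 1)]. *)
have gE : g = (\prod_i (- cycVarInv i) ^+ N i) * shiftPow N.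
  rewrite -big_split /=; apply: eq_bigr => i _; rewrite -exprMn.
  by rewrite mulrBr mulr1 mulNr mulrC cycVarVK opprK addrC.
have Eg : shiftPow N = (\prod_i (- x i) ^+ N i) * g.
  rewrite -big_split /=; apply: eq_bigr => i _; rewrite -exprMn.
  by rewrite mulrBr mulr1 mulNr cycVarVK opprK addrC.
split=> [dual_f|f_ann _ [h ->]].
  rewrite mulrC Eg -mulrA [g * f]cycDot_nondegenerate ?mulr0 // => h.
  by rewrite -adj mulrC; apply: dual_f; exists h.
by rewrite -/(cycDot _ _) mulrC adj gE -mulrA [_ * f]mulrC f_ann mulr0 cycDot0l.
Qed.

Lemma shiftPowD m m' :
  shiftPow m * shiftPow m' = shiftPow (fun i => m i + m' i)%N.
Proof. by rewrite -big_split; apply: eq_bigr => i _; rewrite exprD. Qed.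

Definition shiftMon (a : box) : R := shiftPow (fun i => a i).

Lemma dim_cycRing : \dim {:R} = #|box|.
Proof. exact: dimvf. Qed.

(** * The basis of products of powers of the [x i - 1] *)

Section Nilpotent.
(** Characteristic [p] enters the section only through this nilpotency. *)
Hypothesis shift_nilp : forall i, (x i - 1) ^+ d i = 0.

Lemma shiftPow_eq0 m i : (d i <= m i)%N -> shiftPow m = 0.
Proof.
move=> le_dm; rewrite /shiftPow (bigD1 i) //= -(subnK le_dm) exprD.
by rewrite shift_nilp mulr0 mul0r.
Qed.

Lemma shiftPow_box m (m_lt : forall i, (m i < d i)%N) :
  shiftPow m = shiftMon [ffun i => Ordinal (m_lt i)].
Proof. by apply: eq_bigr => i _; rewrite ffunE. Qed.

Local Notation W := <<codom shiftMon>>%VS.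

Lemma shiftPow_span m : shiftPow m \in W.
Proof.
have [/forallP m_lt|] := boolP [forall i, m i < d i]%N.
  by rewrite (shiftPow_box m_lt) memv_span ?codom_f.
rewrite negb_forall => /existsP[i]; rewrite -leqNgt => /shiftPow_eq0->.
exact: mem0v.
Qed.

(** Since [x i = (x i - 1) + 1], it suffices to multiply by [x i - 1], which raises one exponent of
    each product and so stays in the span. *)
Lemma shiftMon_span_var i v : v \in W -> x i * v \in W.
Proof.
move=> W_v; rewrite -[x i](subrK 1) mulrDl mul1r memvD //.
have := W_v; rewrite -[codom _]in_tupleE => /coord_span->.
rewrite mulr_sumr memv_suml // => k _; rewrite cycScaleAr memvZ //.
have /codomP[a ->] : (in_tuple (codom shiftMon))`_k \in codom shiftMon.
  exact: mem_nth.
suff -> : x i - 1 = shiftPow (fun j => j == i).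
  by rewrite shiftPowD shiftPow_span.
rewrite /shiftPow (bigD1 i) //= eqxx expr1 big1 ?mulr1 // => j /negbTE->.
exact: expr0.
Qed.

(** The span contains 1 and is stable under every [x i], hence contains all monomials. *)
Lemma shiftMon_span : W = fullv.
Proof.
apply/eqP; rewrite eqEsubv subvf; apply/subvP => f _.
rewrite [f]cycMon_sum memv_suml // => m _; rewrite memvZ // cycMonE.
elim/big_rec: _ => [|i v _ W_v].
  rewrite [1](_ : _ = shiftPow (fun=> 0%N)) ?shiftPow_span //.
  by rewrite /shiftPow big1.
by elim: (m i) => [|k IHk]; rewrite ?mul1r // exprS -mulrA shiftMon_span_var.
Qed.

(** A spanning family with as many members as the dimension is free. *)
Lemma shiftMon_free : free (codom shiftMon).
Proof.
suff /basis_free : basis_of fullv (codom shiftMon) by [].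
by rewrite basisEdim shiftMon_span subvv size_codom dim_cycRing leqnn.
Qed.

Lemma shiftMon_inj : injective shiftMon.
Proof. by apply/injectiveP; apply: free_uniq shiftMon_free. Qed.

(** Freeness in terms of coefficients indexed by the box, whereas [free_span] indexes them by
    vectors. *)
Lemma shiftMon_indep (c : box -> F) :
  \sum_a c a *: shiftMon a = 0 -> c =1 fun=> 0.
Proof.
have [k _ k_uniq] := free_span shiftMon_free (mem0v W).
have k_c (c' : box -> F) :
    \sum_a c' a *: shiftMon a = 0 -> forall a, c' a = k (shiftMon a).
  (* [k'] carries [c'] over to vectors through the preimage, unique by [shiftMon_inj], so that it
     can be compared with [k]. *)
  move=> c'0 a; pose k' v := oapp c' 0 [pick b | shiftMon b == v].
  have k'K b : k' (shiftMon b) = c' b.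
    rewrite /k'; case: pickP => [b' /eqP/shiftMon_inj-> //|/(_ b)].
    by rewrite eqxx.
  rewrite -k'K; apply: k_uniq; last exact: codom_f.
  by rewrite -[LHS]c'0 big_image; apply: eq_bigr => b _; rewrite k'K.
move=> /k_c c_k a; rewrite c_k -(k_c (fun=> 0)) // big1 // => b _.
exact: scale0r.
Qed.

(** * The annihilator of [shiftPow N] and the basis of the dual code *)

Variable (N : 'I_n -> nat) (T : {set box}).
(** The sum [a i + N i] is the exponent of [x i - 1] in [shiftMon a * shiftPow N]; no truncated
    subtraction is involved. *)
Hypothesis mem_T :
  forall a : box, reflect (exists i, d i <= a i + N i)%N (a \in T).

Local Notation B := [seq shiftMon a | a in T].

Lemma boxShift_subproof (a : box) i : ((a i + N i) %% d i < d i)%N.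
Proof. by rewrite ltn_mod. Qed.

(* Reducing mod d makes the translation by N a permutation of the whole box. *)
Definition boxShift (a : box) : box :=
  [ffun i => Ordinal (boxShift_subproof a i)].

Lemma boxShift_inj : injective boxShift.
Proof.
move=> a b /ffunP eq_ab; apply/ffunP => i; apply: val_inj.
move: (eq_ab i); rewrite !ffunE => /(congr1 val) /= /eqP.
by rewrite eqn_modDr !modn_small // => /eqP.
Qed.

Lemma shiftMonM_mem a : a \in T -> shiftMon a * shiftPow N = 0.
Proof. by case/mem_T => i le_d; rewrite shiftPowD (shiftPow_eq0 le_d). Qed.

Lemma shiftMonM_notin a :
  a \notin T -> shiftMon a * shiftPow N = shiftMon (boxShift a).
Proof.
move=> T'a; rewrite shiftPowD; apply: eq_bigr => i _; rewrite ffunE /=.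
rewrite modn_small // ltnNge; apply: contra T'a => le_d.
by apply/mem_T; exists i.
Qed.

Lemma annihilator_span f : f \in <<B>>%VS <-> f * shiftPow N = 0.
Proof.
split=> [|f_ann].
  rewrite -[B]in_tupleE => /coord_span->.
  rewrite mulr_suml big1 // => k _; rewrite cycScaleAl.
  have /imageP[a /shiftMonM_mem aN ->] : (in_tuple B)`_k \in B.
    exact: mem_nth.
  by rewrite aN scaler0.
have : f \in W by rewrite shiftMon_span memvf.
move=> /(free_span shiftMon_free)[k + _]; rewrite big_image => f_eq.
have c0 a : a \notin T -> k (shiftMon a) = 0.
  (* [c] gives the coefficients of [f * shiftPow N]: those of [f] moved along [boxShift], with 0 at
     the images of [T], whose terms vanish in the product. *)
  pose c b :=
    let a := invF boxShift_inj b in if a \in T then 0 else k (shiftMon a).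
  suff /shiftMon_indep/(_ (boxShift a)) : \sum_b c b *: shiftMon b = 0.
    by rewrite /c invF_f => + /negbTE T'a; rewrite T'a.
  rewrite -[RHS]f_ann f_eq mulr_suml (reindex boxShift); last first.
    by exists (invF boxShift_inj) => b _; rewrite ?invF_f ?f_invF.
  apply: eq_bigr => b _; rewrite cycScaleAl /c invF_f.
  case: ifPn => [/shiftMonM_mem->|/shiftMonM_notin-> //].
  by rewrite scale0r scaler0.
rewrite f_eq memv_suml // => a _; have [Ta|/c0->] := boolP (a \in T).
  by rewrite memvZ ?memv_span ?image_f.
by rewrite scale0r mem0v.
Qed.

Lemma dualCode_basis :
  basisOfSet (dualCode (principalIdeal (shiftPow N))) B.
Proof.
exists <<B>>%VS; split=> [f|].
  by rewrite annihilator_span dualCode_principal.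
rewrite /basis_of eqxx /=.
(* Up to order, the members outside [T] complete [B] to the whole basis, so [B] inherits
   freeness. *)
have eqB :
    perm_eq (B ++ [seq shiftMon a | a in [predC T]]) (codom shiftMon).
  by rewrite codomE /image_mem -map_cat perm_map // !enumT perm_filterC.
by have := shiftMon_free; rewrite -(perm_free eqB) cat_free => /andP[].
Qed.

End Nilpotent.
End CyclicDot.

(** The iterated Frobenius map is additive, so the power is [x ^+ (p ^ s i) - 1], which is 0 in the
    quotient. *)
Lemma shift_nilpotent (p : nat) (F : fieldType) (n : nat) (s : 'I_n -> nat)
    (d_gt0 : forall i, (0 < p ^ s i)%N) i :
  p \in [pchar F] -> (cycVar F d_gt0 i - 1) ^+ (p ^ s i) = 0.
Proof.
move=> pcharF; have pcharR : p \in [pchar (cycRing F d_gt0)].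
  rewrite inE; case/andP: (pcharF) => -> /eqP p0.
  by rewrite -(rmorph_nat (cycProj d_gt0)) -mpolyC_nat p0 rmorph0 eqxx.
have pN : [pchar (cycRing F d_gt0)].-nat (p ^ s i)%N.
  rewrite (eq_pnat _ (pcharf_eq pcharR)) pnatX.
  by rewrite pnat_id ?(pcharf_prime pcharF).
by rewrite exprDn_pchar // exprNn_pchar // expr1n cycVarX subrr.
Qed.

Theorem mainTheorem5 (p : nat) (p_prime : prime p)
    (Fq : finFieldType) (charFq : p \in [pchar Fq])
    (n : nat) (n_gt0 : (0 < n)%N)
    (s : 'I_n -> nat) (s_gt0 : forall j, (0 < s j)%N)
    (N : 'I_n -> nat) (N_le : forall j, (N j <= p ^ s j)%N) :
  let R := cycRing Fq (prime_exp_gt0 s p_prime) in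
  let x (j : 'I_n) : R := cycVar Fq (prime_exp_gt0 s p_prime) j in
  let C : R -> Prop := principalIdeal (\prod_(j < n) (x j - 1) ^+ N j) in
  let box : finType := expBox (fun l : 'I_n => (p ^ s l)%N) in
  let T_ (j : 'I_n) : {set box} := [set a : box | (p ^ s j - N j <= a j)%N] in
  let T : {set box} := \bigcup_(j < n) T_ j in
  let B : seq R :=
    [seq \prod_(j < n) (x j - 1) ^+ (a j : nat) | a : box in T] in
  basisOfSet (V := R) (dualCode (C : R -> Prop)) B.
Proof.
move=> R x C box T_ T B; apply: dualCode_basis.
  by move=> i; apply: shift_nilpotent.
(* [leq_subLR] trades the truncated lower bound on [a i] for the additive form. *)
move=> a; apply: (iffP bigcupP) => [[i _]|[i le_d]].
  by rewrite inE leq_subLR addnC; exists i.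
by exists i; rewrite // inE leq_subLR addnC.
Qed.
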